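(* Let $k>1$ and $0\le q<p$ be integers, and let $$L=V((u_1,\overline{v_1}),\dots,(u_m,\overline{v_m}),(r_1,s_1),\dots,(r_n,s_n),(p,kp+q))$$ be a V-link, where the overlined and non-overlined blocks are allowed to be empty. Consider the following four T-link presentations of $L$, after the standard simplifications: $$T_1=T\big((r_1,s_1),\dots,(r_n,s_n),(p,kp+q-u_m),(p+v_m,u_m-u_{m-1}),\dots,(p+v_m+\cdots+v_2,u_2-u_1),(p+v_m+\cdots+v_1,u_1)\big),$$ $$T_2=T\big((u_1,v_1),\dots,(u_m,v_m),(kp+q,p-r_n),(kp+q+s_n,r_n-r_{n-1}),\dots,(kp+q+s_n+\cdots+s_2,r_2-r_1),(kp+q+s_n+\cdots+s_1,r_1)\big),$$ $$T_3=T\big((u_1,v_1),\dots,(u_m,v_m),(p,(k-1)p),(p+q,p-r_n),(p+q+s_n,r_n-r_{n-1}),\dots,(p+q+s_n+\cdots+s_2,r_2-r_1),(p+q+s_n+\cdots+s_1,r_1)\big),$$ $$T_4=T\big((r_1,s_1),\dots,(r_n,s_n),(p,q),(kp,p-u_m),(kp+v_m,u_m-u_{m-1}),\dots,(kp+v_m+\cdots+v_2,u_2-u_1),(kp+v_m+\cdots+v_1,u_1)\big).$$ Then $T_1,T_2,T_3,T_4$ are pairwise distinct (as ordered parameter lists) under any of the following conditions: (1) $m,n\ge 1$, $0<q<p$, $u_m<p$, and the ordered blocks $((r_1,s_1),\dots,(r_n,s_n))$ and $((u_1,v_1),\dots,(u_m,v_m))$ are distinct; (2) $m=0$, $n\ge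 1$; (3) $n=0$, $m\ge 1$, $0<q<p$, and $u_m<p$.
   Context: T-links: for integers $2\le r_1<\dots<r_n$ and $s_1,\dots,s_n>0$, the T-link $T((r_1,s_1),\dots,(r_n,s_n))$ is the closure in $S^3$ of the braid $(\sigma_1\cdots\sigma_{r_1-1})^{s_1}\cdots(\sigma_1\cdots\sigma_{r_n-1})^{s_n}$ on $r_n$ strands; the ordered parameter list is called a T-link presentation. V-links: let $p,Q$ be integers with $2\le p\le Q$, let $2\le u_1<\dots<u_m\le p$ and $2\le r_1<\dots<r_n<p$ be possibly empty sequences of integers, and let $v_1,\dots,v_m,s_1,\dots,s_n$ be positive integers. The V-link $V((u_1,\overline{v_1}),\dots,(u_m,\overline{v_m}),(r_1,s_1),\dots,(r_n,s_n),(p,Q))$ is the closure of the braid on $p$ strands $$(\sigma_{p-1}\cdots\sigma_{p-u_1+1})^{v_1}\cdots(\sigma_{p-1}\cdots\sigma_{p-u_m+1})^{v_m}(\sigma_1\cdots\sigma_{r_1-1})^{s_1}\cdots(\sigma_1\cdots\sigma_{r_n-1})^{s_n}(\sigma_1\cdots\sigma_{p-1})^{Q}.$$ Standard simplifications of a parameter list: pairs with second coordinate zero are omitted, and consecutive pairs with the same first coordinate are combined by adding their second coordinates. Empty blocks: in the formulas, $u_0=0$ and $r_0=0$, and terms of an empty block are omitted. Thus for $m=0$, $T_1$ ends with $(p,kp+q)$ and $T_4$ ends with $(p,q),(kp,p)$; for $n=0$, $T_2$ ends with $(kp+q,p)$ and $T_3$ ends with $(p,(k-1)p),(p+q,p)$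 (before simplification). *)

(* Defs.v *)
From mathcomp Require Import all_boot.

Set Implicit Arguments.
Unset Strict Implicit.
Unset Printing Implicit Defensive.

(* A parameter block ((a_1, b_1), ..., (a_l, b_l)). *)
Definition block := seq (nat * nat).

(* 2 <= a_1 < ... < a_l and b_1, ..., b_l > 0.  For a nonempty block this is
   exactly the condition to be a T-link presentation. *)
Definition wf_block (b : block) : bool :=
  sorted ltn (unzip1 b) && all (fun x => (2 <= x.1) && (0 < x.2)) b.

(* Parameters of V((u_1, bar v_1), ..., (u_m, bar v_m),
                   (r_1, s_1), ..., (r_n, s_n), (p, Q))
   with us = ((u_i, v_i))_i (the overlined block) and rs = ((r_i, s_i))_i. *)
Definition Vlink_params (us rs : block) (p Q : nat) : bool :=
  [&& 2 <= p <= Q,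
      wf_block us, all (fun x => x.1 <= p) us,
      wf_block rs & all (fun x => x.1 < p) rs].

(* Coordinates numbered from 1, with the convention a_0 = 0. *)
Definition fstc (b : block) (i : nat) : nat := nth 0 (0 :: unzip1 b) i.
Definition sndc (b : block) (i : nat) : nat := nth 0 (0 :: unzip2 b) i.

(* a_l, which is a_0 = 0 when the block is empty. *)
Definition last_fst (b : block) : nat := fstc b (size b).

(* (c + b_l, a_l - a_(l-1)), ..., (c + b_l + ... + b_2, a_2 - a_1),
   (c + b_l + ... + b_1, a_1) *)
Definition staircase (c : nat) (b : block) : block :=
  [seq (c + \sum_(i <= j < (size b).+1) sndc b j, fstc b i - fstc b i.-1)
  | i <- rev (iota 1 (size b))].

(* Zero pairs have to be dropped before neighbours are combined, since dropping
   a pair can make two pairs with equal first coordinate adjacent. *)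
Fixpoint combine (b : block) : block :=
  if b is x :: b' then
    if combine b' is y :: b'' then
      if x.1 == y.1 then (x.1, x.2 + y.2) :: b'' else [:: x, y & b'']
    else [:: x]
  else [::].

Definition simplify (b : block) : block := combine [seq x <- b | x.2 != 0].

(* Under Vlink_params us rs p (k * p + q) and 1 < k, none of the natural
   number subtractions below, nor those in staircase, is truncated. *)
Definition T1 (us rs : block) (p k q : nat) : block := simplify
  (rs ++ (p, k * p + q - last_fst us) :: staircase p us).

Definition T2 (us rs : block) (p k q : nat) : block := simplify
  (us ++ (k * p + q, p - last_fst rs) :: staircase (k * p + q) rs).

Definition T3 (us rs : block) (p k q : nat) : block := simplify
  (us ++ [:: (p, (k - 1) * p), (p + q, p - last_fst rs)
           & staircase (p + q) rs]).

Definition T4 (us rs : block) (p k q : nat) : block := simplify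
  (rs ++ [:: (p, q), (k * p, p - last_fst us) & staircase (k * p) us]).

(* Main.v *)
(* For each i, the sum of the second coordinates of the pairs with first
   coordinate i is unchanged by the simplifications. Below p these weights
   recover the block rs from T1 and T4, and us from T2 and T3. At p they
   separate T1 from T4 (the weights are at least k * p + q - u_m > q, and
   exactly q) and T2 from T3 (zero, and at least (k - 1) * p). *)
Require Import Defs.
From mathcomp Require Import all_boot zify.

Definition weight (b : block) (i : nat) : nat := \sum_(x <- b | x.1 == i) x.2.

Lemma weight_cons x b i :
  weight (x :: b) i = (if x.1 == i then x.2 else 0) + weight b i.
Proof. by rewrite /weight big_cons; case: ifP. Qed.

Lemma weight_cat b1 b2 i : weight (b1 ++ b2) i = weight b1 i + weight b2 i.
Proof. exact: big_cat. Qed.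

Lemma weight_eq0 b i : all (fun x => x.1 != i) b -> weight b i = 0.
Proof.
by move=> /allP bi; rewrite /weight big_seq_cond big1 // => x /andP[/bi/negPf->].
Qed.

Lemma weight_combine b i : weight (combine b) i = weight b i.
Proof.
elim: b => //= x b IHb; rewrite weight_cons -IHb.
case: (combine b) => [|y c]; first by rewrite weight_cons.
case: ifP => [/eqP xy|_]; rewrite !weight_cons //= xy.
by case: ifP => _; lia.
Qed.

Lemma weight_simplify b i : weight (simplify b) i = weight b i.
Proof.
rewrite /simplify weight_combine; elim: b => //= x b IHb.
by case: eqP => [x0|_]; rewrite !weight_cons IHb ?x0 ?if_same.
Qed.

Lemma weight_mem b x : uniq (unzip1 b) -> x \in b -> weight b x.1 = x.2.
Proof.
elim: b => //= y b IHb /andP[yb ub]; rewrite inE weight_cons.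
case/predU1P => [->|xb].
  rewrite eqxx weight_eq0 ?addn0 //; apply/allP => z zb.
  by apply: contraNneq yb => <-; exact: map_f.
rewrite IHb // ifN //; apply: contraNneq yb => ->; exact: map_f.
Qed.

(** First coordinates in a well-formed block are distinct, so each weight comes from at most one
    pair; positivity of [x.2] rules out the weight 0 of an absent coordinate. *)
Lemma mem_wf_block b x : wf_block b ->
  (x \in b) = (0 < x.2) && (weight b x.1 == x.2).
Proof.
move=> /andP[sb /allP pb].
have ub : uniq (unzip1 b) by exact: sorted_uniq ltn_trans ltnn _ sb.
apply/idP/andP => [xb|[x_gt0 /eqP wx]].
  by have /andP[_ ->] := pb _ xb; rewrite weight_mem.
have [/hasP[y yb /eqP yx]|] := boolP (has (fun y => y.1 == x.1) b).
  suff -> : x = y by [].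
  by apply/eqP; rewrite -pair_eqE /pair_eq yx eqxx -wx -yx weight_mem /=.
by rewrite -all_predC => /weight_eq0; rewrite wx => x0; rewrite x0 in x_gt0.
Qed.

(** A strictly sorted sequence is determined by its members, and [mem_wf_block] reads these off from
    the weights. *)
Lemma wf_block_inj b1 b2 :
  wf_block b1 -> wf_block b2 -> weight b1 =1 weight b2 -> b1 = b2.
Proof.
move=> w1 w2 e12.
have tr : transitive (relpre (@fst nat nat) ltn) by move=> ? ? ? /ltn_trans; apply.
apply: (irr_sorted_eq tr) => [x||| x]; first exact: ltnn.
- by rewrite -sorted_map; case/andP: w1.
- by rewrite -sorted_map; case/andP: w2.
by rewrite !mem_wf_block // e12.
Qed.

Lemma weight_above b p i : all (fun x => x.1 < p) b -> p <= i -> weight b i = 0.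
Proof.
move=> bp p_le; apply: weight_eq0; apply: sub_all bp => x x_lt.
by rewrite ltn_eqF // (leq_trans x_lt).
Qed.

Lemma weight_staircase_lt c b i : i < c -> weight (staircase c b) i = 0.
Proof.
move=> i_lt; apply: weight_eq0; rewrite all_map; apply/allP => j _ /=.
by rewrite gtn_eqF // ltn_addr.
Qed.

Lemma last_fst_lt b p : wf_block b -> last_fst b < p ->
  all (fun x => x.1 < p) b.
Proof.
rewrite /last_fst /fstc => /andP[+ _]; elim/last_ind: b => // b x _.
rewrite size_rcons /unzip1 map_rcons /= nth_rcons size_map ltnn eqxx.
rewrite (sorted_pairwise ltn_trans) pairwise_rcons.
rewrite all_rcons all_map => /andP[bx _] xp; rewrite xp /=.
by apply: sub_all bx => y /= /ltn_trans; apply.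
Qed.

Section Weights.

Variables (us rs : block) (p k q : nat).
Hypothesis k_gt1 : 1 < k.
Hypothesis q_lt_p : q < p.

(** Positivity of [p] comes from [q < p]. Pairs placed at [k * p] or beyond thus contribute nothing
    at [p]. *)
Let p_lt_kp : p < k * p.
Proof. by nia. Qed.

(** In each of the four lists only the leading block can reach below [p]: the remaining pairs start
    at [p], [p + q], [k * p] or [k * p + q], and a staircase only adds to its base. *)
Lemma weight_T1_lt i : i < p -> weight (T1 us rs p k q) i = weight rs i.
Proof.
move=> i_lt; rewrite weight_simplify weight_cat weight_cons /=.
by rewrite gtn_eqF // weight_staircase_lt // !addn0.
Qed.

Lemma weight_T2_lt i : i < p -> weight (T2 us rs p k q) i = weight us i.
Proof.
move=> i_lt; rewrite weight_simplify weight_cat weight_cons /=.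
by rewrite gtn_eqF ?weight_staircase_lt ?addn0 //; lia.
Qed.

Lemma weight_T3_lt i : i < p -> weight (T3 us rs p k q) i = weight us i.
Proof.
move=> i_lt; rewrite weight_simplify weight_cat !weight_cons /=.
by rewrite !gtn_eqF ?weight_staircase_lt ?addn0 //; lia.
Qed.

Lemma weight_T4_lt i : i < p -> weight (T4 us rs p k q) i = weight rs i.
Proof.
move=> i_lt; rewrite weight_simplify weight_cat !weight_cons /=.
by rewrite !gtn_eqF ?weight_staircase_lt ?addn0 //; lia.
Qed.

Lemma weight_T1_p : k * p + q - last_fst us <= weight (T1 us rs p k q) p.
Proof.
by rewrite weight_simplify weight_cat weight_cons /= eqxx; lia.
Qed.

Lemma weight_T2_p :
  all (fun x => x.1 < p) us -> weight (T2 us rs p k q) p = 0.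
Proof.
move=> us_lt; rewrite weight_simplify weight_cat weight_cons /=.
rewrite (weight_above _ _ _ us_lt) // gtn_eqF ?weight_staircase_lt //; lia.
Qed.

(** Only a lower bound, since for [q = 0] the pair at [p + q] also counts at [p]. *)
Lemma weight_T3_p : (k - 1) * p <= weight (T3 us rs p k q) p.
Proof.
by rewrite weight_simplify weight_cat !weight_cons /= eqxx; lia.
Qed.

Lemma weight_T4_p :
  all (fun x => x.1 < p) rs -> weight (T4 us rs p k q) p = q.
Proof.
move=> rs_lt; rewrite weight_simplify weight_cat !weight_cons /= eqxx.
by rewrite (weight_above _ _ _ rs_lt) // gtn_eqF ?weight_staircase_lt ?addn0.
Qed.

End Weights.

Theorem theorem5p10 (k q p : nat) (us rs : block) :
  1 < k -> q < p ->
  Vlink_params us rs p (k * p + q) ->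
  [\/ [/\ 0 < size us /\ 0 < size rs, 0 < q < p, last_fst us < p & rs <> us],
      size us = 0 /\ 0 < size rs
    | [/\ size rs = 0, 0 < size us, 0 < q < p & last_fst us < p]] ->
  uniq [:: T1 us rs p k q; T2 us rs p k q; T3 us rs p k q; T4 us rs p k q].
Proof.
move=> k_gt1 q_lt /and5P[_ wf_us _ wf_rs rs_lt] cases.
(* All three conditions reduce to these two facts: when exactly one block is empty the blocks
   differ, and an empty [us] has [last_fst us = 0 < p]. *)
have [um_lt rs_us] : last_fst us < p /\ rs <> us.
  case: cases => [[_ _ ? ?]|[/size0nil-> rs_gt0]|[/size0nil-> us_gt0 _ ?]] //.
    by split; [exact: leq_trans q_lt | case: (rs) rs_gt0].
  by split=> //; case: (us) us_gt0.
have us_lt := last_fst_lt _ _ wf_us um_lt.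
(* Handles the four comparisons of [T1] or [T4] with [T2] or [T3]. If [X = Y], the weights of [rs]
   and [us] agree below [p]; from [p] on both vanish, so the blocks would coincide. *)
have rs_us_lt X Y : (forall i, i < p -> weight X i = weight rs i) ->
    (forall i, i < p -> weight Y i = weight us i) -> X <> Y.
  move=> wX wY XY; apply/rs_us/wf_block_inj => // i.
  have [i_lt|p_le] := ltnP i p; first by rewrite -wX // XY wY.
  by rewrite (weight_above _ _ _ rs_lt) // (weight_above _ _ _ us_lt).
have T12 : (T1 us rs p k q == T2 us rs p k q) = false.
  by apply/eqP/rs_us_lt => i; [exact: weight_T1_lt | exact: weight_T2_lt].
have T13 : (T1 us rs p k q == T3 us rs p k q) = false.
  by apply/eqP/rs_us_lt => i; [exact: weight_T1_lt | exact: weight_T3_lt].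
have T42 : (T4 us rs p k q == T2 us rs p k q) = false.
  by apply/eqP/rs_us_lt => i; [exact: weight_T4_lt | exact: weight_T2_lt].
have T43 : (T4 us rs p k q == T3 us rs p k q) = false.
  by apply/eqP/rs_us_lt => i; [exact: weight_T4_lt | exact: weight_T3_lt].
have T14 : (T1 us rs p k q == T4 us rs p k q) = false.
  apply/eqP => eT; have := weight_T1_p us rs p k q.
  (* Equality would give [k * p + q - last_fst us <= q], against [last_fst us < p < k * p]. *)
  by rewrite eT weight_T4_p //; nia.
have T23 : (T2 us rs p k q == T3 us rs p k q) = false.
  apply/eqP => eT; have := weight_T3_p us rs p k q.
  (* Equality would give [(k - 1) * p <= 0], although [k > 1] and [p > 0]. *)
  by rewrite -eT weight_T2_p //; nia.
by rewrite /= !inE T12 T13 T14 T23 ![_ == T4 _ _ _ _ _]eq_sym T42 T43.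
Qed.
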